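(* Let $V=\mathbb R^{m,m}$, $m\ge1$, and let $S=S_{m,m}=\wedge U$ be its spinor module, with bilinear forms $f$ and $f_E$ as in the context. Every $\mathfrak{so}(m,m)$-equivariant embedding $V^*\hookrightarrow S^*\otimes S^*$ is a linear combination of the embeddings $j_\rho(f)$ and $j_\rho(f_E)$. Their images are contained in the dual of the following subspaces, depending on $m\pmod 4$: - $m\equiv1$: $j_\rho(f)$: $\vee^2S^++\vee^2S^-$; $j_\rho(f_E)$: $\vee^2S^++\vee^2S^-$. - $m\equiv2$: $j_\rho(f)$: $S^+\vee S^-$; $j_\rho(f_E)$: $S^+\wedge S^-$. - $m\equiv3$: $j_\rho(f)$: $\wedge^2S^++\wedge^2S^-$; $j_\rho(f_E)$: $\wedge^2S^++\wedge^2S^-$. - $m\equiv4$: $j_\rho(f)$: $S^+\wedge S^-$; $j_\rho(f_E)$: $S^+\vee S^-$.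
   Context: Write $V=\mathbb R^{m,m}=U+U^*$ with complementary isotropic subspaces, $U^*$ identified with the dual of $U$ by $u^*(u)=\langle u,u^*\rangle$; $V^*\cong V$ by the scalar product. $C\ell_{m,m}$ has the convention $v^2=-\langle v,v\rangle$. Its irreducible module is $S=\wedge U$ with $\rho(u)s=u\wedge s$, $\rho(u^* )s=-2\,u^*\angle s$ (interior multiplication). $S^+=\wedge^{ev}U$, $S^-=\wedge^{odd}U$, $E|S^\pm=\pm\mathrm{Id}$. Fix $0\ne vol\in\wedge^mU$; $f$ is the bilinear form on $S$ with $f(\wedge^iU,\wedge^jU)=0$ if $i+j\neq m$ and $f(s,t)\,vol=(-1)^{i(i+1)/2}s\wedge t$ for $s\in\wedge^iU$, $t\in\wedge^{m-i}U$; $f_E=f(E\cdot,\cdot)$. For a bilinear form $\beta$, $j_\rho(\beta)(v)=\beta(\rho(v)\cdot,\cdot)$. ''Image contained in the dual of'' a subspace means that every form $j(v)$ on $S$ is: symmetric with $S^+\perp S^-$ for $\vee^2S^++\vee^2S^-$; symmetric with $S^+$ and $S^-$ isotropic for $S^+\vee S^-$; skew symmetric with $S^+\perp S^-$ for $\wedge^2S^++\wedge^2S^-$; skew symmetric with $S^+$ and $S^-$ isotropic for $S^+\wedge S^-$. *)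

(* Defs.v *)
From HB Require Import structures.
From mathcomp Require Import all_boot all_order all_algebra.
From mathcomp Require Import reals ring lra.

Set Implicit Arguments.
Unset Strict Implicit.
Unset Printing Implicit Defensive.

Import Order.TTheory GRing.Theory Num.Theory.
Local Open Scope ring_scope.

(* U = R^m is the space of row vectors and U^* that of column vectors, a
   column a being the linear form u |-> u *m a on U; V = U + U^*. *)
Definition hyp_space (R : realType) (m : nat) : Type :=
  ('rV[R]_m * 'cV[R]_m)%type.

(* The exterior algebra of U: the coordinate of s at A = {i_1 < ... < i_k} is
   the coefficient of the basis vector e_{i_1} /\ ... /\ e_{i_k}. *)
Definition spinor (R : realType) (m : nat) : Type := {ffun {set 'I_m} -> R^o}.

Section Spinors.
Variables (R : realType) (m : nat).
Implicit Types (u : 'rV[R]_m) (a : 'cV[R]_m) (v w x y : hyp_space R m).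
Implicit Types (s t : spinor R m) (A B C : {set 'I_m}).

Definition dual_eval a u : R := (u *m a) 0 0.

(* U and U^* are isotropic and <u, a> = a(u). *)
Definition scal v w : R := dual_eval v.2 w.1 + dual_eval w.2 v.1.

(* For disjoint A and B, e_A /\ e_B = (-1)^(inv_count A B) e_(A :|: B). *)
Definition inv_count A B : nat :=
  #|[set p : 'I_m * 'I_m | [&& p.1 \in A, p.2 \in B & (p.2 < p.1)%N]]|.

Definition wedge s t : spinor R m :=
  [ffun C : {set 'I_m} =>
    \sum_(A : {set 'I_m} | A \subset C)
      (-1) ^+ inv_count A (C :\: A) * s A * t (C :\: A)].

Definition vec u : spinor R m :=
  [ffun A : {set 'I_m} => \sum_(i < m | A == [set i]) u 0 i].

(* Interior multiplication: the coefficient of e_B in a angle e_(i |: B), for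
   i \notin B, is a(e_i) times the sign of e_i /\ e_B with respect to
   e_(i |: B). *)
Definition contract a s : spinor R m :=
  [ffun B : {set 'I_m} =>
    \sum_(i < m | i \notin B) (-1) ^+ inv_count [set i] B * a i 0 * s (i |: B)].

Definition rho v s : spinor R m := wedge (vec v.1) s - 2 *: contract v.2 s.

Definition ext_power (k : nat) s : Prop := forall A, #|A| != k -> s A = 0.
Definition ext_even s : Prop := forall A, odd #|A| -> s A = 0.
Definition ext_odd s : Prop := forall A, ~~ odd #|A| -> s A = 0.

Definition parity s : spinor R m :=
  [ffun A : {set 'I_m} => (-1) ^+ #|A| * s A].

(* The defining property of f, relative to a volume element vol. *)
Definition spinor_form_spec (vol : spinor R m) (f : spinor R m -> spinor R m -> R)
    : Prop :=
  (forall i j s t, (i + j)%N <> m -> ext_power i s -> ext_power j t ->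
     f s t = 0) /\
  (forall i s t, (i <= m)%N -> ext_power i s -> ext_power (m - i) t ->
     f s t *: vol = (-1) ^+ (i * i.+1)./2 *: wedge s t).

(* Membership in so(m,m), the Lie algebra of skew endomorphisms of V. *)
Definition skew_endo (X : hyp_space R m -> hyp_space R m) : Prop :=
  forall v w, scal (X v) w + scal v (X w) = 0.

Definition baseU (i : 'I_m) : hyp_space R m := (delta_mx 0 i, 0).
Definition baseUd (i : 'I_m) : hyp_space R m := (0, delta_mx i 0).

(* The spin representation of so(m,m): if (b_k) is a basis of V and (b'_k) its
   dual basis for the scalar product, X acts by -1/4 sum_k rho(X b_k) rho(b'_k).
   By spin_rep_plane and spin_rep_comm below, this is the inverse of
   spin(m,m) = span [x, y] -> so(m,m), c |-> (v |-> [c, v]), composed with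
   rho. *)
Definition spin_rep (X : hyp_space R m -> hyp_space R m) s : spinor R m :=
  - 4^-1 *: \sum_(i < m) (rho (X (baseU i)) (rho (baseUd i) s)
                          + rho (X (baseUd i)) (rho (baseU i) s)).

Definition form_E (b : spinor R m -> spinor R m -> R) s t : R :=
  b (parity s) t.

Definition j_rho (b : spinor R m -> spinor R m -> R) v s t : R := b (rho v s) t.

(* V^* is identified with V by the scalar product and S^* \otimes S^* with
   the space of bilinear forms on S. *)
Definition equivariant_embedding
    (j : hyp_space R m -> spinor R m -> spinor R m -> R) : Prop :=
  [/\ forall v, bilinear_for *%R *%R (j v),
      forall s t, scalar (fun v => j v s t),
      forall v, (forall s t, j v s t = 0) -> v = 0
    & forall X : {linear hyp_space R m -> hyp_space R m}, skew_endo X ->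
        forall v s t,
          j (X v) s t = - j v (spin_rep X s) t - j v s (spin_rep X t)].

Section Image.
Variable b : spinor R m -> spinor R m -> R.

Definition form_sym : Prop := forall s t, b s t = b t s.
Definition form_skew : Prop := forall s t, b s t = - b t s.
Definition half_orthogonal : Prop :=
  forall s t, ext_even s -> ext_odd t -> b s t = 0 /\ b t s = 0.
Definition half_isotropic : Prop :=
  (forall s t, ext_even s -> ext_even t -> b s t = 0) /\
  (forall s t, ext_odd s -> ext_odd t -> b s t = 0).

Definition in_sym2_dual : Prop := form_sym /\ half_orthogonal.
Definition in_sym_mixed_dual : Prop := form_sym /\ half_isotropic.
Definition in_alt2_dual : Prop := form_skew /\ half_orthogonal.
Definition in_alt_mixed_dual : Prop := form_skew /\ half_isotropic.

End Image.

(* The rest of the file checks the sign conventions (wedgeA,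
   clifford_relation), that spin_rep is the spin representation
   (spin_rep_plane, spin_rep_comm) and that f exists (spinor_form_exists). *)

Let eps (i : 'I_m) C : R := (-1) ^+ inv_count [set i] C.

Let inv1E (i : 'I_m) C : inv_count [set i] C = #|[set j in C | (j < i)%N]|.
Proof.
rewrite /inv_count -(card_imset (mem [set j in C | (j < i)%N]) (f := pair i)); last by move=> ? ? [].
apply: eq_card => -[j k]; rewrite !inE /=; apply/idP/imsetP => [|[l]].
  by case/and3P=> /eqP-> kC ki; exists k; rewrite // !inE kC.
by rewrite !inE => /andP[lC li] [-> ->]; rewrite eqxx lC.
Qed.

Let flip (i j : 'I_m) : R := (-1) ^+ (i < j)%N.

Let flip2 i j : flip i j * flip i j = 1.
Proof. by rewrite -expr2 sqrr_sign. Qed.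

Let flipC i j : i != j -> flip i j = - flip j i.
Proof.
by rewrite /flip -val_eqE /= neq_ltn; case: ltngtP => //= _ _; rewrite ?expr1 ?expr0 ?opprK.
Qed.

Let flipii i : flip i i = 1.
Proof. by rewrite /flip ltnn. Qed.

Let epsU1 i j C : i \notin C -> eps j (i |: C) = flip i j * eps j C.
Proof.
move=> iC; rewrite /eps /flip -exprD !inv1E; congr (_ ^+ _).
rewrite (cardsD1 i) !inE eqxx /=; congr (_ + _)%N.
by apply: eq_card => k; rewrite !inE; case: eqP => [->|] //=; rewrite (negPf iC).
Qed.

Let epsD1 i j C : i \in C -> eps j (C :\ i) = flip i j * eps j C.
Proof.
move=> iC; rewrite -[in RHS](setD1K iC) epsU1 ?setD11 //.
by rewrite mulrA flip2 mul1r.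
Qed.

(* rho v is a combination of the operators e_i /\ _ and e_i^* angle _. *)
Definition create (i : 'I_m) s : spinor R m :=
  [ffun C : {set 'I_m} => if i \in C then eps i C * s (C :\ i) else 0].

Definition annih (i : 'I_m) s : spinor R m :=
  [ffun C : {set 'I_m} => if i \in C then 0 else eps i C * s (i |: C)].

Let cr_lin i : linear (create i).
Proof.
move=> k s t; apply/ffunP => C; rewrite !ffunE; case: ifP => _; last first.
  by rewrite scaler0 addr0.
by rewrite mulrDr; congr (_ + _); exact: mulrCA.
Qed.

Let an_lin i : linear (annih i).
Proof.
move=> k s t; apply/ffunP => C; rewrite !ffunE; case: ifP => _.
  by rewrite scaler0 addr0.
by rewrite mulrDr; congr (_ + _); exact: mulrCA.
Qed.

HB.instance Definition _ i := GRing.isLinear.Build R _ _ _ (create i) (cr_lin i).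
HB.instance Definition _ i := GRing.isLinear.Build R _ _ _ (annih i) (an_lin i).

Let cr_cr i j s : create i (create j s) + create j (create i s) = 0.
Proof.
have [-> | ij] := eqVneq i j.
  by apply/ffunP => C; rewrite !ffunE !inE eqxx /= mulr0 if_same addr0.
apply/ffunP => C; rewrite !ffunE !inE ij (eq_sym j) ij /=.
case: (boolP (i \in C)) => iC; case: (boolP (j \in C)) => jC;
  rewrite ?mulr0 ?addr0 //.
rewrite !epsD1 // (flipC ij) !setDDl (setUC [set j]); ring.
Qed.

Let an_an i j s : annih i (annih j s) + annih j (annih i s) = 0.
Proof.
have [-> | ij] := eqVneq i j.
  by apply/ffunP => C; rewrite !ffunE !inE eqxx /= mulr0 if_same addr0.
apply/ffunP => C; rewrite !ffunE !inE (negPf ij) (eq_sym j) (negPf ij) /=.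
case: (boolP (i \in C)) => iC; case: (boolP (j \in C)) => jC;
  rewrite ?mulr0 ?addr0 //.
rewrite !epsU1 // (flipC ij) !setUA (setUC [set j]); ring.
Qed.

Let cr_an i j s : create i (annih j s) + annih j (create i s) = (i == j)%:R *: s.
Proof.
have [-> | ij] := eqVneq i j; apply/ffunP => C; rewrite !ffunE !inE.
  rewrite eqxx /= scale1r; case: ifP => jC.
    by rewrite setD1K // addr0 epsD1 // flipii mul1r mulrA -expr2 sqrr_sign mul1r.
  rewrite setU1K ?jC // add0r epsU1 ?jC // flipii mul1r mulrA -expr2.
  by rewrite sqrr_sign mul1r.
rewrite (eq_sym j) (negPf ij) /= scale0r.
case: (boolP (i \in C)) => iC; case: (boolP (j \in C)) => jC;
  rewrite ?mulr0 ?addr0 //.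
rewrite epsD1 // epsU1 // (flipC ij).
suff -> : j |: C :\ i = (j |: C) :\ i by ring.
by apply/setP => k; rewrite !inE; case: (eqVneq k j) => [->|//] /=; rewrite eq_sym ij.
Qed.


Let rhoE v s :
  rho v s = \sum_i (v.1 0 i *: create i s - (2 * v.2 i 0) *: annih i s).
Proof.
have wE : wedge (vec v.1) s = \sum_i v.1 0 i *: create i s.
  apply/ffunP => C; rewrite ffunE sum_ffunE.
  under eq_bigr => A _.
    rewrite ffunE mulrAC mulr_sumr.
    over.
  rewrite (exchange_big_dep xpredT) //=; apply: eq_bigr => i _.
  rewrite !ffunE; case: ifP => iC.
    rewrite (big_pred1 [set i]) => [|A]; last first.
      by rewrite andbC /=; case: (eqVneq A [set i]) => [->|_] /=; rewrite ?sub1set ?iC.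
    rewrite /eps !inv1E [RHS]mulrC; congr (_ ^+ _ * _ * _).
    apply: eq_card => k; rewrite !inE.
    by case: (eqVneq k i) => [->|//]; rewrite ltnn !andbF.
  rewrite scaler0 big_pred0 // => A.
  by apply/negP => /andP[sAC /eqP AE]; rewrite AE sub1set iC in sAC.
have cE : contract v.2 s = \sum_i v.2 i 0 *: annih i s.
  apply/ffunP => C; rewrite ffunE sum_ffunE big_mkcond; apply: eq_bigr => i _.
  rewrite !ffunE; case: (i \in C); rewrite /= ?scaler0 //.
  by rewrite -mulrA; exact: mulrCA.
rewrite /rho wE cE scaler_sumr -sumrB; apply: eq_bigr => i _.
by rewrite scalerA.
Qed.

Let rho_linr v : linear (rho v).
Proof.
move=> k s t; rewrite !rhoE scaler_sumr -big_split; apply: eq_bigr => i _ /=.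
rewrite !linearP /=; apply/ffunP => C; rewrite !ffunE /GRing.scale /=; ring.
Qed.

HB.instance Definition _ v := GRing.isLinear.Build R _ _ _ (rho v) (rho_linr v).

Let rho_linl s : linear (rho^~ s).
Proof.
move=> k v w; rewrite !rhoE scaler_sumr -big_split; apply: eq_bigr => i _ /=.
rewrite !mxE; apply/ffunP => C; rewrite !ffunE /GRing.scale /=; ring.
Qed.

Let rhoD v s t : rho v (s + t) = rho v s + rho v t.
Proof. exact: (linearD (rho v)). Qed.

Let rhoZ v (k : R) s : rho v (k *: s) = k *: rho v s.
Proof. exact: (linearZ_LR (rho v)). Qed.

Let rhoB v s t : rho v (s - t) = rho v s - rho v t.
Proof. exact: (linearB (rho v)). Qed.

Let rhoS v (F : 'I_m -> spinor R m) : rho v (\sum_i F i) = \sum_i rho v (F i).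
Proof. exact: (linear_sum (rho v)). Qed.

Definition rho_flip s v := rho v s.

HB.instance Definition _ s :=
  GRing.isLinear.Build R _ _ _ (rho_flip s) (rho_linl s).

Let rho_comm v w s :
  rho v (rho w s) + rho w (rho v s) = - (2 * scal v w) *: s.
Proof.
have e x y : rho x (rho y s) = \sum_i \sum_j
    (x.1 0 i *: create i (y.1 0 j *: create j s - (2 * y.2 j 0) *: annih j s)
     - (2 * x.2 i 0) *: annih i (y.1 0 j *: create j s - (2 * y.2 j 0) *: annih j s)).
  rewrite [LHS]rhoE; apply: eq_bigr => i _.
  rewrite rhoE (linear_sum (create i)) (linear_sum (annih i)) !scaler_sumr.
  by rewrite -sumrB.
have scE : scal v w = \sum_i (v.1 0 i * w.2 i 0 + v.2 i 0 * w.1 0 i).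
  rewrite /scal /dual_eval !mxE addrC -big_split; apply: eq_bigr => i _ /=.
  by rewrite [w.1 _ _ * _]mulrC.
have ij (a b c d : R) i j :
    (a *: create i (c *: create j s - (2 * d) *: annih j s)
     - (2 * b) *: annih i (c *: create j s - (2 * d) *: annih j s))
    + (c *: create j (a *: create i s - (2 * b) *: annih i s)
     - (2 * d) *: annih j (a *: create i s - (2 * b) *: annih i s))
    = (- (2 * (a * d + b * c)) * (i == j)%:R) *: s.
  have := cr_cr i j s; have := an_an i j s; have := cr_an i j s.
  have := cr_an j i s; rewrite (eq_sym j).
  rewrite !linearB !linearZ /=.
  move=> /eqP; rewrite eq_sym -subr_eq => /eqP <-.
  move=> /eqP; rewrite addrC eq_sym -subr_eq => /eqP <-.
  move=> /eqP; rewrite addr_eq0 => /eqP->.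
  move=> /eqP; rewrite addr_eq0 => /eqP->.
  apply/ffunP => C; rewrite !ffunE /GRing.scale /=; ring.
rewrite !e [X in _ + X]exchange_big -big_split scE mulr_sumr -sumrN scaler_suml.
apply: eq_bigr => i _; rewrite -big_split /= (bigD1 i) //= big1 => [|j ji].
  by rewrite addr0 ij eqxx mulr1.
by rewrite ij eq_sym (negPf ji) mulr0 scale0r.
Qed.

Let invE A B : inv_count A B =
  (\sum_(p : 'I_m * 'I_m) [&& p.1 \in A, p.2 \in B & (p.2 < p.1)%N])%N.
Proof.
rewrite /inv_count -sum1_card big_mkcond; apply: eq_bigr => p _; rewrite inE.
by case: ifP.
Qed.

Let invUl A B C : [disjoint A & B] -> inv_count (A :|: B) C = (inv_count A C + inv_count B C)%N.
Proof.
move=> dAB; rewrite !invE -big_split; apply: eq_bigr => p _; rewrite !inE /=.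
have := disjointFr dAB (x := p.1).
by case: (p.1 \in A) => [->|] //=; rewrite addn0.
Qed.

Let invUr A B C : [disjoint A & B] -> inv_count C (A :|: B) = (inv_count C A + inv_count C B)%N.
Proof.
move=> dAB; rewrite !invE -big_split; apply: eq_bigr => p _; rewrite !inE /=.
have := disjointFr dAB (x := p.2).
by case: (p.2 \in A) => [->|] //=; rewrite ?andbF ?addn0.
Qed.

Lemma wedgeA : associative (@wedge).
Proof.
move=> s t r; apply/ffunP => C; rewrite !ffunE.
under eq_bigr => A _ do rewrite ffunE mulr_sumr.
under [RHS]eq_bigr => B _ do rewrite ffunE mulr_sumr mulr_suml.
rewrite [RHS](exchange_big_dep (fun A => A \subset C)) /=; last first.
  by move=> B A BC AB; exact: subset_trans AB BC.
apply: eq_bigr => A AC.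
rewrite [RHS](reindex_onto (fun D => A :|: D) (fun B => B :\: A)) /=; last first.
  by move=> B /andP[_ AB]; rewrite setDE setUIr setUCr setIT; apply/setUidPr.
apply: eq_big => [D | D DC].
  rewrite subUset AC subsetUl andbT /= setDUl setDv set0U.
  by rewrite subsetD; congr (_ && _); apply/setDidPl/eqP.
move: DC; rewrite subsetD => /andP[DC dDA].
have dAD : [disjoint A & D] by rewrite disjoint_sym.
have eD : (A :|: D) :\: A = D by rewrite setDUl setDv set0U; apply/setDidPl.
have eC : C :\: (A :|: D) = (C :\: A) :\: D by rewrite setDDl.
rewrite eD eC; set E := (C :\: A) :\: D.
have dDE : [disjoint D & E] by rewrite disjoint_sym /E disjoints_subset setDE subsetIr.
have -> : C :\: A = D :|: E.
  rewrite -[LHS](setID _ D); congr (_ :|: _); apply/setIidPr.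
  by rewrite subsetD DC.
rewrite invUr // invUl // !exprD; ring.
Qed.

Lemma clifford_relation v s : rho v (rho v s) = - scal v v *: s.
Proof.
have /(congr1 ( *:%R 2^-1)) := rho_comm v v s.
by rewrite -mulr2n -scaler_nat !scalerA mulrN mulrA mulVf ?pnatr_eq0 //
  scale1r mul1r.
Qed.

Let base_sum v :
  v = \sum_i (scal v (baseUd i) *: baseU i + scal v (baseU i) *: baseUd i).
Proof.
have pE (p q : hyp_space R m) : p.1 = q.1 -> p.2 = q.2 -> p = q.
  by case: p q => [? ?] [? ?] /= -> ->.
have e1 i : scal v (baseUd i) = v.1 0 i.
  rewrite /scal /dual_eval /= mul0mx ![in LHS]mxE add0r (bigD1 i) //= mxE !eqxx mulr1.
  by rewrite big1 ?addr0 // => j ji; rewrite mxE (negPf ji) mulr0.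
have e2 i : scal v (baseU i) = v.2 i 0.
  rewrite /scal /dual_eval /= mulmx0 ![in LHS]mxE addr0 (bigD1 i) //= mxE !eqxx mul1r.
  by rewrite big1 ?addr0 // => j ji; rewrite mxE (negPf ji) andbF mul0r.
under eq_bigr do rewrite e1 e2.
apply: pE.
  rewrite (big_morph fst (id1 := 0) (op1 := +%R)) //= [LHS]row_sum_delta.
  by apply: eq_bigr => i _ /=; rewrite scaler0 addr0.
rewrite (big_morph snd (id1 := 0) (op1 := +%R)) //=.
rewrite [LHS]matrix_sum_delta; apply: eq_bigr => i _ /=.
by rewrite big_ord1 scaler0 add0r.
Qed.

Let rho_sum v s :
  rho v s = \sum_i (scal v (baseUd i) *: rho (baseU i) s
                    + scal v (baseU i) *: rho (baseUd i) s).
Proof.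
rewrite [LHS](_ : _ = rho_flip s v) // [in LHS](base_sum v) linear_sum.
by apply: eq_bigr => i _; rewrite linearD !linearZ.
Qed.

Lemma spin_rep_plane x y s :
  spin_rep (fun v => scal x v *: y - scal y v *: x) s
    = 4^-1 *: (rho x (rho y s) - rho y (rho x s)).
Proof.
have rB z t : rho (scal x z *: y - scal y z *: x) t
    = scal x z *: rho y t - scal y z *: rho x t.
  by rewrite -!/(rho_flip t _) linearB !linearZ.
rewrite /spin_rep scaleNr -scalerN; congr (_ *: _).
have := rho_sum ^~ s; move: rB rhoD rhoZ rhoS; move: rho scal => r b rB D Z S E.
rewrite (E x) (E y) !S -[LHS]sumrN -[RHS]sumrB; apply: eq_bigr => i _.
rewrite !rB !D !Z; apply/ffunP => C; rewrite !ffunE /GRing.scale /=; ring.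
Qed.

Lemma spin_rep_comm (X : {linear hyp_space R m -> hyp_space R m}) v s :
  skew_endo X ->
  spin_rep X (rho v s) - rho v (spin_rep X s) = rho (X v) s.
Proof.
rewrite /skew_endo /spin_rep => skX.
have scC x y : scal x y = scal y x by exact: addrC.
have Xv : rho (X v) s = \sum_i (scal v (baseUd i) *: rho (X (baseU i)) s
    + scal v (baseU i) *: rho (X (baseUd i)) s).
  rewrite [LHS](_ : _ = rho_flip s (X v)) // [in LHS](base_sum v).
  rewrite (linear_sum X) (linear_sum (rho_flip s)); apply: eq_bigr => i _.
  rewrite (linearD X) !(linearZ_LR X) (linearD (rho_flip s)).
  by rewrite !(linearZ_LR (rho_flip s)).
have := rho_sum ^~ s; move: skX scC Xv rho_comm rhoD rhoZ rhoB rhoS.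
move: rho scal => r b skX scC Xv rC D Z B S E.
have ac x y t : r x (r y t) = - (2 * b x y) *: t - r y (r x t).
  by rewrite -rC addrK.
have mv x y : r x (r y (r v s)) - r v (r x (r y s))
    = - (2 * b v y) *: r x s + (2 * b x v) *: r y s.
  rewrite [r y (r v s)]ac B Z [r x (r v _)]ac (scC y v).
  by apply/ffunP => C; rewrite !ffunE /GRing.scale /=; ring.
have Xv' : r (X v) s = - \sum_i (b (X (baseUd i)) v *: r (baseU i) s
    + b (X (baseU i)) v *: r (baseUd i) s).
  rewrite E -sumrN; apply: eq_bigr => i _.
  have sk y : b (X v) y = - b (X y) v.
    by apply/eqP; rewrite -addr_eq0 (scC _ v) skX.
  by rewrite !sk !scaleNr -opprD.
rewrite Z S -scalerBr -[X in _ *: X]sumrB.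
under eq_bigr do rewrite D opprD addrACA !mv.
have -> : r (X v) s = 2^-1 *: (r (X v) s + r (X v) s).
  by rewrite -mulr2n -scaler_nat scalerA mulVf ?pnatr_eq0 // scale1r.
rewrite {1}Xv Xv' -sumrB !scaler_sumr; apply: eq_bigr => i _.
by apply/ffunP => C; rewrite !ffunE /GRing.scale /=; field.
Qed.

Let spinor_form_fun (vol : spinor R m) s t : R :=
  \sum_(A : {set 'I_m}) (-1) ^+ (#|A| * #|A|.+1)./2 * (-1) ^+ inv_count A (~: A)
    * (vol setT)^-1 * s A * t (~: A).

Let spinor_form_bilinear vol : bilinear_for *%R *%R (spinor_form_fun vol).
Proof.
split=> [t k s s' | s k t t'].
  rewrite /spinor_form_fun /= mulr_sumr -big_split /=; apply: eq_bigr => A _.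
  rewrite !ffunE /GRing.scale /=; ring.
rewrite /spinor_form_fun /= mulr_sumr -big_split /=; apply: eq_bigr => A _.
rewrite !ffunE /GRing.scale /=; ring.
Qed.

Lemma spinor_form_exists vol : ext_power m vol -> vol <> 0 ->
  exists f : {biscalar (spinor R m)}, spinor_form_spec vol f.
Proof.
move=> vol_top vol_neq0.
have volT : vol setT != 0.
  apply/eqP => vT; apply: vol_neq0; apply/ffunP => A; rewrite ffunE.
  have [->//|AT] := eqVneq A setT; apply: vol_top.
  apply: contraNneq AT => cA; rewrite eqEcard subsetT cardsT card_ord.
  by rewrite cA leqnn.
pose f : {biscalar (spinor R m)} := HB.pack (spinor_form_fun vol)
  (bilinear_isBilinear.Build _ _ _ _ _ _ (spinor_form_fun vol)
     (spinor_form_bilinear vol)).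
exists f; split=> [i j s t ijm si tj | i s t im si tmi].
  rewrite /= /spinor_form_fun big1 // => A _.
  have [Ai|Ai] := eqVneq #|A| i; last by rewrite (si A) // mulr0 mul0r.
  rewrite (tj (~: A)) ?mulr0 //; apply: contra_notN ijm => /eqP <-.
  by rewrite -Ai cardsC card_ord.
apply/ffunP => C; rewrite !ffunE /GRing.scale /=.
have [-> | CT] := eqVneq C setT.
  rewrite /spinor_form_fun mulr_suml; apply: (etrans _ (esym (mulr_sumr _ _ _ _))).
  rewrite [RHS](eq_bigl xpredT) => [|A]; last exact: subsetT.
  apply: eq_bigr => A _; rewrite setTD.
  have [<-|Ai] := eqVneq #|A| i; last by rewrite (si A) // !(mulr0, mul0r).
  by field.
have cC : #|C| != m.
  apply: contraNneq CT => cC; rewrite eqEcard subsetT cardsT card_ord.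
  by rewrite cC leqnn.
rewrite vol_top // mulr0 big1 ?mulr0 // => A sAC.
have [Ai|Ai] := eqVneq #|A| i; last by rewrite (si A) // !(mulr0, mul0r).
rewrite (tmi (C :\: A)) ?mulr0 //; apply: contraNneq cC => cD.
by rewrite -(cardsID A C) (setIidPr sAC) cD Ai subnKC.
Qed.

End Spinors.

(* Main.v *)
Require Import Defs.
From HB Require Import structures.
From mathcomp Require Import all_boot all_order all_algebra.
From mathcomp Require Import reals ring lra.

Set Implicit Arguments.
Unset Strict Implicit.
Unset Printing Implicit Defensive.

Import Order.TTheory GRing.Theory Num.Theory.
Local Open Scope ring_scope.

(** Write e_i and e_i^star for the bases of U and of its dual, c_i = rho(e_i)
    for the creation operators, E for the parity of S, and e_A for the basis
    vector of S indexed by a subset A of the indices.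

    The form f pairs e_A nontrivially with e_(~: A) and with no other basis
    vector, so it is nondegenerate. The sign (-1)^(i(i+1)/2) is the one that makes every rho(v) skew for f
    ([form_rho]). For c_i this is a sign computation on basis vectors
    ([form_create]); for rho(e_i^star) it follows from the Clifford relation,
    because S is generated from the vacuum 1 by the c_i. The same generation
    argument gives f(s,t) = (-1)^(m(m+1)/2) f(t,s) ([spinor_formC]) and
    f(Es,t) = (-1)^m f(s,Et) ([form_parity]). As rho(v) also anticommutes with
    E, these three identities give the symmetry type of j_rho(f) and
    j_rho(f_E) and the position of the half spinor spaces
    ([form_type_of_signs]). Skewness of rho(v) makes f invariant under the spin
    representation ([form_spin_rep]), hence j_rho(f) and j_rho(f_E)
    equivariant; they are injective because rho(v) = 0 forces <v, w> = 0 for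
    all w.

    For the converse, let j be equivariant, and let K be the space of all s
    with j(v)(s, _) = 0 for every v. Equivariance under the infinitesimal
    rotations [plane x y] shows that K is stable under all rho(x) rho(y)
    ([left_null_rho2]), so K = S as soon as K contains 1 and one vector e_0 of
    U ([left_null_full]). By weights for the rotations in the planes of e_i and
    e_i^star, the value j(e_0)(1, _) is determined by its coordinate at
    e_(~: {0}), and j(e_0^star)(e_0, _) by its coordinate at e_T with T the
    full set; the remaining values on 1 and e_0 are obtained from these two by
    further rotations. So an equivariant j is determined by two scalars
    ([equivariant_eq0]). These scalars are (p, q) for j_rho(f) and (-p, q) for
    j_rho(f_E) with p and q nonzero, so some linear combination of the two has
    the same scalars as j ([equivariant_embedding_span]). *)

(** * Signs of exterior products *)

Section InversionSigns.
Variable m : nat.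
Implicit Types (i : 'I_m) (A B C : {set 'I_m}).

Lemma inv_countE A B :
  inv_count A B = (\sum_(a in A) \sum_(b in B) (b < a))%N.
Proof.
rewrite /inv_count -sum1_card pair_big_dep big_mkcond [RHS]big_mkcond /=.
by apply: eq_bigr => p _; rewrite inE; case: (p.1 \in A); case: (p.2 \in B);
  case: ltnP.
Qed.

Lemma inv_countU1l i A B :
  i \notin A -> inv_count (i |: A) B = (inv_count [set i] B + inv_count A B)%N.
Proof. by move=> iA; rewrite !inv_countE big_setU1 // big_set1. Qed.

Lemma inv_countU1r i A B :
  i \notin B -> inv_count A (i |: B) = (inv_count A [set i] + inv_count A B)%N.
Proof.
move=> iB; rewrite !inv_countE -big_split; apply: eq_bigr => a _ /=.
by rewrite big_setU1 // big_set1.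
Qed.

Lemma inv_count_diag i : inv_count [set i] [set i] = 0%N.
Proof. by rewrite inv_countE !big_set1 ltnn. Qed.

Lemma inv_count0l B : inv_count set0 B = 0%N.
Proof. by rewrite inv_countE big_set0. Qed.

Lemma inv_count0r A : inv_count A set0 = 0%N.
Proof. by rewrite inv_countE big1 // => a _; rewrite big_set0. Qed.

Lemma inv_count_setD1 i C : inv_count [set i] (C :\ i) = inv_count [set i] C.
Proof.
have [iC | iC] := boolP (i \in C).
  by rewrite -[in RHS](setD1K iC) inv_countU1r ?setD11 // inv_count_diag.
by congr inv_count; apply/setP => j; rewrite !inE; case: eqVneq => [->|//];
  rewrite (negPf iC).
Qed.

Lemma inv_count_swap i A :
  i \notin A -> (inv_count [set i] A + inv_count A [set i] = #|A|)%N.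
Proof.
move=> iA; rewrite !inv_countE big_set1 -big_split -sum1_card.
apply: eq_bigr => a aA; rewrite big_set1 /=.
have : val a != val i by apply: contraNneq iA => /val_inj <-.
by case: ltngtP.
Qed.

End InversionSigns.

(** * The Clifford module S *)

Section CliffordModule.
Variables (R : realType) (m : nat).
Implicit Types (i k : 'I_m) (v w x y : hyp_space R m) (s t : spinor R m).
Implicit Types (A B C : {set 'I_m}).
Notation eU := (baseU R).
Notation eUd := (baseUd R).

Lemma createE i s C :
  create i s C = if i \in C then (-1) ^+ inv_count [set i] C * s (C :\ i) else 0.
Proof. by rewrite ffunE. Qed.

Lemma annihE i s C :
  annih i s C = if i \in C then 0 else (-1) ^+ inv_count [set i] C * s (i |: C).
Proof. by rewrite ffunE. Qed.

Lemma rho_baseU i s : rho (eU i) s = create i s.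
Proof.
apply/ffunP => C; rewrite createE !ffunE /GRing.scale /=.
rewrite [X in _ - 2 * X]big1 => [|k _]; last by rewrite mxE mulr0 mul0r.
rewrite mulr0 subr0.
have vE A : vec (delta_mx 0 i : 'rV[R]_m) A = (A == [set i])%:R.
  rewrite ffunE; case: (eqVneq A [set i]) => [->|Ai].
    rewrite (big_pred1 i) => [|k]; first by rewrite mxE !eqxx.
    by rewrite (inj_eq set1_inj) eq_sym.
  rewrite big1 // => k /eqP Ak; rewrite mxE /=; case: eqVneq => // ki.
  by rewrite Ak ki eqxx in Ai.
have [iC | iC] := boolP (i \in C).
  rewrite (bigD1 [set i]) ?sub1set //= vE eqxx mulr1 inv_count_setD1.
  rewrite big1 ?addr0 // => A /andP[_ /negPf Ai].
  by rewrite vE Ai mulr0 mul0r.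
rewrite big1 // => A AC; rewrite vE; case: eqVneq => [Ai|_].
  by rewrite Ai sub1set (negPf iC) in AC.
by rewrite mulr0 mul0r.
Qed.

Lemma rho_baseUd i s : rho (eUd i) s = - 2 *: annih i s.
Proof.
apply/ffunP => C; rewrite [in RHS]ffunE annihE !ffunE /GRing.scale /=.
rewrite [X in X - _]big1 => [|A _]; last first.
  by rewrite ffunE big1 ?mulr0 ?mul0r // => k _; rewrite mxE.
rewrite sub0r mulNr; congr (- (_ * _)).
have [iC | iC] := boolP (i \in C).
  by rewrite big1 // => k kC; rewrite mxE; case: eqVneq => [ki|_];
    rewrite ?mulr0 ?mul0r //; rewrite ki iC in kC.
rewrite (bigD1 i) //= mxE !eqxx mulr1 big1 ?addr0 // => k /andP[_ /negPf ki].
by rewrite mxE ki mulr0 mul0r.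
Qed.

Lemma scal_linear x : scalar (scal x).
Proof.
move=> k v w; rewrite /scal /dual_eval /= !mulmxDr !mulmxDl.
rewrite -!scalemxAr -!scalemxAl !mxE; ring.
Qed.

HB.instance Definition _ x :=
  GRing.isLinear.Build R _ _ _ (scal x) (scal_linear x).

Lemma scalC v w : scal v w = scal w v.
Proof. exact: addrC. Qed.

Lemma parity_linear : linear (@parity R m).
Proof.
by move=> k s t; apply/ffunP => A; rewrite !ffunE /GRing.scale /=; ring.
Qed.

HB.instance Definition _ :=
  GRing.isLinear.Build R _ _ _ (@parity R m) parity_linear.

Lemma rhoDl v w s : rho (v + w) s = rho v s + rho w s.
Proof. exact: (linearD (rho_flip s)). Qed.

Lemma rhoZl (k : R) v s : rho (k *: v) s = k *: rho v s.
Proof. exact: (linearZ_LR (rho_flip s)). Qed.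

Lemma rho0l s : rho 0 s = 0.
Proof. exact: (linear0 (rho_flip s)). Qed.

Lemma rhoD v s t : rho v (s + t) = rho v s + rho v t.
Proof. exact: (linearD (rho v)). Qed.

Lemma rhoN v s : rho v (- s) = - rho v s.
Proof. exact: (linearN (rho v)). Qed.

Lemma rhoZ (k : R) v s : rho v (k *: s) = k *: rho v s.
Proof. exact: (linearZ_LR (rho v)). Qed.

Lemma rho_anticomm v w s :
  rho v (rho w s) + rho w (rho v s) = - (2 * scal v w) *: s.
Proof.
have := clifford_relation (v + w) s.
rewrite rhoDl !(rhoDl v w s) !(rhoD _ (rho v s)) !(clifford_relation _ s).
rewrite (linearD (scal _)) /= ![scal (v + w) _]scalC !(linearD (scal _)) /= (scalC w v).
move: (rho v (rho w s)) (rho w (rho v s)) => a b E; have {E} : a + b =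
    - (scal v v + scal v w + (scal v w + scal w w)) *: s
    + scal v v *: s + scal w w *: s.
  rewrite -E !scaleNr; apply/ffunP => A; rewrite !ffunE /GRing.scale /=; ring.
by move->; apply/ffunP => A; rewrite !ffunE /GRing.scale /=; ring.
Qed.

Lemma scalUU i k : scal (eU i) (eU k) = 0.
Proof. by rewrite /scal /dual_eval /= !mulmx0 mxE addr0. Qed.

Lemma scalDD i k : scal (eUd i) (eUd k) = 0.
Proof. by rewrite /scal /dual_eval /= !mul0mx mxE addr0. Qed.

Lemma scalUD i k : scal (eU i) (eUd k) = (i == k)%:R.
Proof.
rewrite /scal /dual_eval /= mul0mx mxE add0r.
rewrite mul_delta_mx_cond; case: eqVneq => _; rewrite ?mulr1n ?mulr0n ?mxE //.
Qed.

Lemma scalDU i k : scal (eUd i) (eU k) = (i == k)%:R.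
Proof. by rewrite scalC scalUD eq_sym. Qed.

Lemma scal_eUd v i : scal v (eUd i) = v.1 0 i.
Proof. by rewrite /scal /dual_eval /= mul0mx -colE !mxE add0r. Qed.

Lemma scal_eU v i : scal v (eU i) = v.2 i 0.
Proof. by rewrite /scal /dual_eval /= mulmx0 -rowE !mxE addr0. Qed.

Lemma base_decomp v :
  v = \sum_i (v.1 0 i *: eU i + v.2 i 0 *: eUd i).
Proof.
have pE (p q : hyp_space R m) : p.1 = q.1 -> p.2 = q.2 -> p = q.
  by case: p q => [? ?] [? ?] /= -> ->.
apply: pE.
  rewrite (big_morph fst (id1 := 0) (op1 := +%R)) //= [LHS]row_sum_delta.
  by apply: eq_bigr => i _ /=; rewrite scaler0 addr0.
rewrite (big_morph snd (id1 := 0) (op1 := +%R)) //=.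
rewrite [LHS]matrix_sum_delta; apply: eq_bigr => i _ /=.
by rewrite big_ord1 scaler0 add0r.
Qed.

Lemma scal_nondegenerate v : (forall w, scal v w = 0) -> v = 0.
Proof.
move=> v0; rewrite [v]base_decomp big1 // => i _.
by rewrite -scal_eUd -scal_eU !v0 !scale0r addr0.
Qed.

Lemma hyp_space_ind (P : hyp_space R m -> Prop) :
  P 0 -> (forall (k : R) v w, P v -> P w -> P (k *: v + w)) ->
  (forall i, P (eU i)) -> (forall i, P (eUd i)) -> forall v, P v.
Proof.
move=> P0 Plin PU PD v; rewrite [v]base_decomp; apply: (big_ind P) => // [x y Px Py|i _].
  by rewrite -[x]scale1r; apply: (Plin).
by apply: (Plin) => //; rewrite -[_ *: _]addr0; apply: (Plin).
Qed.

(** The basis vector e_A of S. *)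
Definition ebase A : spinor R m := [ffun B => (B == A)%:R].

Lemma ebase_decomp s : s = \sum_A s A *: ebase A.
Proof.
apply/ffunP => B; rewrite sum_ffunE (bigD1 B) //= !ffunE eqxx /GRing.scale /=.
rewrite mulr1 big1 ?addr0 // => A AB.
by rewrite !ffunE eq_sym (negPf AB) /GRing.scale /= mulr0.
Qed.

Lemma create_ebase i A : i \notin A ->
  create i (ebase A) = (-1) ^+ inv_count [set i] A *: ebase (i |: A).
Proof.
move=> iA; apply/ffunP => C; rewrite createE !ffunE /GRing.scale /=.
have [-> | CA] := eqVneq C (i |: A).
  by rewrite setU11 setU1K // eqxx inv_countU1r // inv_count_diag.
rewrite mulr0; case: ifP => // iC; case: eqVneq => [Ci|_]; last by rewrite mulr0.
by rewrite -Ci setD1K ?eqxx in CA.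
Qed.

Lemma annih_ebase i A : i \notin A ->
  annih i (ebase (i |: A)) = (-1) ^+ inv_count [set i] A *: ebase A.
Proof.
move=> iA; apply/ffunP => C; rewrite annihE !ffunE /GRing.scale /=.
have [-> | CA] := eqVneq C A; first by rewrite (negPf iA) eqxx.
rewrite mulr0; case: ifP => // /negbT iC; case: eqVneq => [Ci|_]; last by rewrite mulr0.
by rewrite -(setU1K iC) Ci setU1K ?eqxx in CA.
Qed.

Lemma annih_ebase0 i A : i \notin A -> annih i (ebase A) = 0.
Proof.
move=> iA; apply/ffunP => C; rewrite annihE !ffunE.
case: ifP => // iC; case: eqVneq => [Ci|_]; last by rewrite mulr0.
by rewrite -Ci setU11 in iA.
Qed.

Lemma spinor_lin_ind (P : spinor R m -> Prop) :
  P 0 -> (forall (k : R) s t, P s -> P t -> P (k *: s + t)) ->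
  (forall A, P (ebase A)) -> forall s, P s.
Proof.
move=> P0 Plin Pb s; rewrite [s]ebase_decomp; apply: (big_ind P) => // [x y Px Py|A _].
  by rewrite -[x]scale1r; apply: (Plin).
by rewrite -[_ *: _]addr0; apply: (Plin).
Qed.

(** S is generated from the vacuum, the unit of the exterior algebra, by the
    creation operators: a property stable under linear combinations and
    creation operators holds on S as soon as it holds at the vacuum. *)
Lemma spinor_ind (P : spinor R m -> Prop) :
  (forall (k : R) s t, P s -> P t -> P (k *: s + t)) ->
  P (ebase set0) -> (forall i s, P s -> P (create i s)) -> forall s, P s.
Proof.
move=> Plin P1 Pc.
have P0 : P 0 by have := Plin (-1) _ _ P1 P1; rewrite scaleN1r addNr.
apply: spinor_lin_ind => // A.
elim: {A}#|A| {-2}A (erefl #|A|) => [A /eqP|n IHn A An].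
  by rewrite cards_eq0 => /eqP->.
have /set0Pn[i iA] : A != set0 by rewrite -cards_eq0 An.
have {IHn} : P (ebase (A :\ i)).
  by apply: IHn; apply/eqP; rewrite -eqSS -An (cardsD1 i A) iA.
move/(Pc i); rewrite create_ebase ?setD11 // setD1K // inv_count_setD1.
move=> /(fun H => Plin ((-1) ^+ inv_count [set i] A) _ _ H P0).
by rewrite addr0 scalerA -expr2 sqrr_sign scale1r.
Qed.

Lemma parity_create i s : parity (create i s) = - create i (parity s).
Proof.
apply/ffunP => C; rewrite [in RHS]ffunE createE ffunE createE.
case: ifP => iC; last by rewrite mulr0 oppr0.
by rewrite ffunE (cardsD1 i C) iC exprS; ring.
Qed.

Lemma parity_annih i s : parity (annih i s) = - annih i (parity s).
Proof.
apply/ffunP => C; rewrite [in RHS]ffunE annihE ffunE annihE.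
case: ifP => iC; first by rewrite mulr0 oppr0.
by rewrite ffunE cardsU1 iC exprS; ring.
Qed.

Lemma parity_rho v s : parity (rho v s) = - rho v (parity s).
Proof.
elim/hyp_space_ind: v => [|k v w Pv Pw|i|i].
- by rewrite !rho0l linear0 oppr0.
- rewrite (rhoDl (k *: v) w s) (rhoZl k v s) (linearP (@parity R m)) /= Pv Pw.
  by rewrite (rhoDl (k *: v) w (parity s)) (rhoZl k v (parity s)) scalerN -opprD.
- by rewrite !rho_baseU parity_create.
- by rewrite !rho_baseUd linearZ /= parity_annih scalerN.
Qed.

Lemma parity_ebase A : parity (ebase A) = (-1) ^+ #|A| *: ebase A.
Proof.
apply/ffunP => B; rewrite !ffunE /GRing.scale /=.
by case: eqVneq => [->//|_]; rewrite !mulr0.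
Qed.

End CliffordModule.

(** * The invariant form f *)

Section InvariantForm.
Variables (R : realType) (m : nat) (vol : spinor R m).
Hypotheses (vol_top : ext_power m vol) (vol_neq0 : vol <> 0).
Variable f : {biscalar (spinor R m)}.
Hypothesis f_spec : spinor_form_spec vol f.
Implicit Types (i : 'I_m) (v w x y : hyp_space R m) (s t : spinor R m).
Implicit Types (A B C : {set 'I_m}) (c : R).
Notation eU := (baseU R).
Notation eUd := (baseUd R).

Lemma vol_setT_neq0 : vol setT != 0.
Proof.
apply/eqP => vT; apply: vol_neq0; apply/ffunP => A; rewrite ffunE.
have [->//|AT] := eqVneq A setT; apply: vol_top.
by apply: contraNneq AT => cA; rewrite eqEcard subsetT cardsT card_ord cA leqnn.
Qed.

(** The value of f(e_A, e_(~: A)) when vol is e_T, with T the full set. *)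
Definition pairing_sign A : R :=
  (-1) ^+ (#|A| * #|A|.+1)./2 * (-1) ^+ inv_count A (~: A).

Lemma pairing_sign_neq0 A : pairing_sign A != 0.
Proof. by rewrite mulf_neq0 ?signr_eq0. Qed.

Lemma ext_power_ebase A : ext_power #|A| (ebase R A).
Proof. by move=> B BA; rewrite ffunE; case: (eqVneq B A) BA => [->|//]; rewrite eqxx. Qed.

Lemma wedge_ebase_setT A B :
  wedge (ebase R A) (ebase R B) setT = (B == ~: A)%:R * (-1) ^+ inv_count A (~: A).
Proof.
rewrite ffunE (bigD1 A) ?subsetT //= !ffunE eqxx setTD (eq_sym (~: A)) mulr1.
rewrite big1 ?addr0 => [|C /andP[_ /negPf CA]]; first by rewrite mulrC.
by rewrite ffunE CA mulr0 mul0r.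
Qed.

Lemma form_ebase A B :
  f (ebase R A) (ebase R B) * vol setT = (B == ~: A)%:R * pairing_sign A.
Proof.
have [AB | AB] := eqVneq (#|A| + #|B|)%N m; last first.
  have [f0 _] := f_spec.
  rewrite (f0 _ _ _ _ _ (@ext_power_ebase A) (@ext_power_ebase B)) ?mul0r; last exact/eqP.
  case: eqVneq => [BA|_]; last by rewrite mul0r.
  by case/eqP: AB; rewrite BA cardsC card_ord.
have Am : (#|A| <= m)%N by rewrite -[X in (_ <= X)%N]AB leq_addr.
have Bm : ext_power (m - #|A|) (ebase R B).
  by move: (@ext_power_ebase B); rewrite -[X in (X - _)%N]AB addKn.
have [_ fm] := f_spec; have /ffunP/(_ setT) := fm _ _ _ Am (@ext_power_ebase A) Bm.
rewrite [LHS]ffunE [RHS]ffunE wedge_ebase_setT /GRing.scale /= => ->.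
by rewrite mulrCA.
Qed.

(** Bilinearity of f, with the scalar action on R written as a product, in
    statements about variables that can be instantiated explicitly: the defining
    sums of the operators rho would otherwise match the addition in the general
    rules. *)
Lemma biscalarZl c s t : f (c *: s) t = c * f s t.
Proof. exact: linearZl_LR. Qed.

Lemma biscalarZr c s t : f s (c *: t) = c * f s t.
Proof. exact: linearZr_LR. Qed.

Lemma biscalarDl s s' t : f (s + s') t = f s t + f s' t.
Proof. exact: linearDl. Qed.

Lemma biscalarDr s t t' : f s (t + t') = f s t + f s t'.
Proof. exact: linearDr. Qed.

Lemma biscalarPl c s s' t : f (c *: s + s') t = c * f s t + f s' t.
Proof. exact: linearPl. Qed.

Lemma biscalarPr c s t t' : f s (c *: t + t') = c * f s t + f s t'.
Proof. exact: linearPr. Qed.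

Lemma biscalarNl s t : f (- s) t = - f s t.
Proof. exact: linearNl. Qed.

Lemma biscalarNr s t : f s (- t) = - f s t.
Proof. exact: linearNr. Qed.

Lemma form_coord s t :
  f s t * vol setT = \sum_A pairing_sign A * s A * t (~: A).
Proof.
rewrite {1}[s]ebase_decomp linear_sumlz mulr_suml; apply: eq_bigr => A _.
have fB B : s A * (t B * f (ebase R A) (ebase R B)) * vol setT
    = s A * t B * ((B == ~: A)%:R * pairing_sign A).
  by rewrite -form_ebase; ring.
rewrite biscalarZl {1}[t]ebase_decomp linear_sumr mulr_sumr mulr_suml.
rewrite (bigD1 (~: A)) //= big1 => [|B /negPf BA].
  by rewrite biscalarZr fB eqxx mul1r addr0 mulrC mulrA.
by rewrite biscalarZr fB BA mul0r mulr0.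
Qed.

(** By [form_coord], the product of f with the top coordinate of vol does not
    depend on vol; identities for f are proved after multiplication by this
    nonzero scalar. *)
Lemma form_inj (a b : R) : a * vol setT = b * vol setT -> a = b.
Proof. exact/mulIf/vol_setT_neq0. Qed.

Lemma form_ebase_neq0 A : f (ebase R A) (ebase R (~: A)) != 0.
Proof.
apply: contraTneq isT => fA; have := form_ebase A (~: A).
by rewrite fA eqxx mul0r mul1r => /esym/eqP; rewrite (negPf (pairing_sign_neq0 A)).
Qed.

Lemma form_nondegenerate s : (forall t, f s t = 0) -> s = 0.
Proof.
move=> fs0; apply/ffunP => A; rewrite ffunE.
have := form_coord s (ebase R (~: A)); rewrite fs0 mul0r (bigD1 A) //= big1.
  rewrite ffunE eqxx mulr1 addr0 => /esym/eqP.
  by rewrite mulf_eq0 (negPf (pairing_sign_neq0 A)) => /eqP.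
by move=> B BA; rewrite ffunE (inj_eq (@setC_inj _)) (negPf BA) mulr0.
Qed.

(** f(1, t) is the top coordinate of t, up to the normalization by vol. *)
Lemma form1E t : f (ebase R set0) t * vol setT = t setT.
Proof.
rewrite form_coord (bigD1 set0) //= big1 => [|A /negPf A0]; last first.
  by rewrite ffunE A0 mulr0 mul0r.
by rewrite /pairing_sign cards0 inv_count0l ffunE eqxx setC0 !expr0 !mul1r addr0.
Qed.

(** Moving e_i from the right to the left factor of the pairing. The exponents
    of the two degree factors differ by |A| + 1: the |A| makes up for commuting
    e_i with e_A, and only the minus sign remains. *)
Lemma pairing_sign_setU1 i A : i \notin A ->
  pairing_sign (i |: A) * (-1) ^+ inv_count [set i] A
    = - (pairing_sign A * (-1) ^+ inv_count [set i] (~: A)).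
Proof.
move=> iA; set B := ~: (i |: A).
have iB : i \notin B by rewrite !inE eqxx.
have AB : ~: A = i |: B.
  apply/setP => k; rewrite /B !inE negb_or.
  by case: (eqVneq k i) => [->|//]; rewrite iA.
rewrite /pairing_sign -/B AB cardsU1 iA !inv_countU1r // inv_countU1l //.
rewrite inv_count_diag !exprD expr0.
have sw := inv_count_swap iA.
have -> : (((1 + #|A|) * (1 + #|A|).+1)./2 = #|A|.+1 + (#|A| * #|A|.+1)./2)%N.
  set n := #|A|; rewrite add1n.
  have -> : (n.+1 * n.+2 = n.+1.*2 + n * n.+1)%N by rewrite -muln2; ring.
  by rewrite halfD odd_double doubleK.
set p : R := (-1) ^+ inv_count [set i] A; set q : R := (-1) ^+ inv_count A [set i].
have pp : p * p = 1 by rewrite -expr2 sqrr_sign.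
have pq : (-1) ^+ #|A|.+1 = - (p * q) by rewrite exprS mulN1r -sw exprD.
rewrite exprD pq.
transitivity (- (p * p) * ((-1) ^+ (#|A| * #|A|.+1)./2 * q * (-1) ^+ inv_count [set i] B * (-1) ^+ inv_count A B)).
  by ring.
by rewrite pp; ring.
Qed.

Lemma form_create i s t : f (create i s) t = - f s (create i t).
Proof.
apply: form_inj; rewrite mulNr !form_coord -sumrN.
rewrite (bigID (fun A => i \in A)) [RHS](bigID (fun A => i \in A)) /=.
rewrite [X in _ + X]big1 => [|A /negPf iA]; last by rewrite createE iA mulr0 mul0r.
rewrite [X in _ = X + _]big1 => [|A iA]; last by rewrite createE inE iA mulr0 oppr0.
rewrite addr0 add0r (reindex_onto (fun A => i |: A) (fun A => A :\ i)) /=; last first.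
  by move=> A; apply: setD1K.
apply: eq_big => [A | A /andP[_ /eqP Ai]].
  rewrite setU11 /=; apply/eqP/idP => [<-|]; first by rewrite setD11.
  exact: setU1K.
have iA : i \notin A by rewrite -Ai setD11.
rewrite !createE setU11 inE iA setU1K // inv_countU1r // inv_count_diag add0n.
have -> : ~: A :\ i = ~: (i |: A) by apply/setP => k; rewrite !inE negb_or.
rewrite mulrA (pairing_sign_setU1 iA); ring.
Qed.

(** With a = rho(e_i^star), the skewness of the c_k and the Clifford relation
    show that the defect f(a s, t) + f(s, a t) takes the same value at
    (c_k s, t) as at (s, c_k t). It vanishes when s is the vacuum, because a
    kills the vacuum and a t has no top coordinate. *)
Lemma form_baseUd i s t : f (rho (eUd i) s) t = - f s (rho (eUd i) t).
Proof.
have ac (k : 'I_m) r : create k (rho (eUd i) r) + rho (eUd i) (create k r)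
    = - (2 * (k == i)%:R) *: r.
  by rewrite -!rho_baseU rho_anticomm scalUD.
elim/spinor_ind: s t => [c s s' IHs IHs' t||k s IHs t].
- rewrite (rhoD (eUd i) (c *: s) s') (rhoZ c (eUd i) s).
  by rewrite (biscalarPl c (rho (eUd i) s)) (biscalarPl c s) IHs IHs' mulrN opprD.
- move=> t; apply: form_inj; rewrite mulNr form1E.
  rewrite !rho_baseUd annih_ebase0 ?inE // scaler0 linear0l mul0r.
  by rewrite ffunE annihE inE /= scaler0 oppr0.
have -> : rho (eUd i) (create k s)
    = - (2 * (k == i)%:R) *: s - create k (rho (eUd i) s).
  by rewrite -ac addrC addKr.
rewrite (biscalarPl _ s) biscalarNl !form_create !opprK IHs.
have -> : create k (rho (eUd i) t)
    = - (2 * (k == i)%:R) *: t - rho (eUd i) (create k t).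
  by rewrite -ac addrK.
by rewrite (biscalarPr _ s t) biscalarNr.
Qed.

Lemma form_rho v s t : f (rho v s) t = - f s (rho v t).
Proof.
elim/hyp_space_ind: v => [|c v w Pv Pw|i|i].
- by rewrite !rho0l linear0l linear0r oppr0.
- rewrite (rhoDl (c *: v) w s) (rhoZl c v s) (biscalarPl c (rho v s)) Pv Pw.
  by rewrite (rhoDl (c *: v) w t) (rhoZl c v t) (biscalarPr c s (rho v t)) mulrN opprD.
- by rewrite !rho_baseU form_create.
- exact: form_baseUd.
Qed.

Lemma spinor_formC s t : f s t = (-1) ^+ (m * m.+1)./2 * f t s.
Proof.
elim/spinor_ind: s t => [k s s' IHs IHs' t||i s IHs t].
- by rewrite biscalarPl biscalarPr IHs IHs'; ring.
- move=> t; apply: form_inj; rewrite form1E -mulrA form_coord.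
  rewrite (bigD1 setT) //= big1 => [|A /negPf AT].
    rewrite setCT ffunE eqxx mulr1 addr0 mulrA /pairing_sign setCT.
    by rewrite inv_count0r mulr1 cardsT card_ord -expr2 sqrr_sign mul1r.
  by rewrite ffunE -setCT (inj_eq (@setC_inj _)) AT mulr0.
- by rewrite form_create IHs form_create mulrN opprK.
Qed.

Lemma form_parity s t : f (parity s) t = (-1) ^+ m * f s (parity t).
Proof.
elim/spinor_ind: s t => [k s s' IHs IHs' t||i s IHs t].
- rewrite (linearP (@parity R m)) /= !biscalarDl !biscalarZl IHs IHs'; ring.
- move=> t; apply: form_inj; rewrite parity_ebase cards0 scale1r -mulrA !form1E.
  by rewrite ffunE cardsT card_ord mulrA -expr2 sqrr_sign mul1r.
- rewrite parity_create biscalarNl !form_create opprK IHs parity_create biscalarNr; ring.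
Qed.

(** Taking adjoints reverses the products rho(X b) rho(b'); restoring the order
    costs the trace of X, which is zero because X is skew. *)
Lemma form_spin_rep (X : {linear hyp_space R m -> hyp_space R m}) s t :
  skew_endo X -> f (spin_rep X s) t = - f s (spin_rep X t).
Proof.
move=> skX; rewrite /spin_rep biscalarZl biscalarZr linear_sumlz linear_sumr -mulrN.
congr (_ * _); rewrite -sumrN; apply: eq_bigr => i _.
have tr0 : scal (eUd i) (X (eU i)) + scal (eU i) (X (eUd i)) = 0.
  by rewrite (scalC (eUd i)); exact: skX.
have trace_cancel (p q r h l : R) :
    p + q = 0 -> - (2 * p) * r - h + (- (2 * q) * r - l) = - (h + l).
  by move=> /eqP; rewrite addrC addr_eq0 => /eqP->; ring.
have adj x y : f (rho x (rho y s)) t = - (2 * scal y x) * f s t - f s (rho x (rho y t)).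
  rewrite (form_rho x) (form_rho y) opprK -biscalarZr -biscalarNr -biscalarDr.
  by rewrite -(rho_anticomm y x) addrK.
apply: (etrans (biscalarDl _ _ _)).
apply: (etrans (congr2 +%R (adj (X (eU i)) (eUd i)) (adj (X (eUd i)) (eU i)))).
apply: (etrans _ (congr1 -%R (esym (biscalarDr _ _ _)))).
exact: trace_cancel tr0.
Qed.

End InvariantForm.

(** * Equivariance and symmetry type *)

Section Embeddings.
Variables (R : realType) (m : nat).
Implicit Types (v w : hyp_space R m) (s t : spinor R m).

(** A nondegenerate form invariant under the spin representation gives an
    equivariant embedding of V. *)
Lemma j_rho_embedding (b : spinor R m -> spinor R m -> R) :
  bilinear_for *%R *%R b ->
  (forall s, (forall t, b s t = 0) -> s = 0) ->
  (forall X : {linear hyp_space R m -> hyp_space R m}, skew_endo X ->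
     forall s t, b (spin_rep X s) t = - b s (spin_rep X t)) ->
  equivariant_embedding (j_rho b).
Proof.
move=> [bl br] b_nd b_spin; split=> [v | s t | v v0 | X skX v s t].
- split=> [t c s s' | s c t t'] /=; last exact: br.
  by rewrite /j_rho (rhoD v (c *: s) s') (rhoZ c v s); exact: bl.
- move=> c v w; rewrite /j_rho (rhoDl (c *: v) w s) (rhoZl c v s); exact: bl.
(* If rho(v) = 0, the Clifford relation at the vacuum gives <v, w> = 0. *)
- have rho0 s : rho v s = 0 by apply: b_nd; exact: v0.
  apply: scal_nondegenerate => w.
  have := rho_anticomm v w (ebase R set0); rewrite !rho0 (linear0 (rho w)) addr0.
  move=> /ffunP/(_ set0) /eqP; rewrite !ffunE eqxx /GRing.scale /= mulr1.
  by rewrite eq_sym oppr_eq0 mulf_eq0 pnatr_eq0 => /eqP.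
- rewrite /j_rho -(spin_rep_comm v s skX).
  have bB (x y : spinor R m) : b (x - y) t = b x t - b y t.
    by have := bl t (-1) y x; rewrite /= scaleN1r mulN1r ![- _ + _]addrC.
  by rewrite bB (b_spin X skX) addrC.
Qed.

Lemma parity_even s : ext_even s -> parity s = s.
Proof.
move=> s_ev; apply/ffunP => A; rewrite ffunE -signr_odd.
by have [/s_ev->|_] := boolP (odd #|A|); rewrite ?mulr0 // mul1r.
Qed.

Lemma parity_odd s : ext_odd s -> parity s = - s.
Proof.
move=> s_odd; apply/ffunP => A; rewrite !ffunE -signr_odd.
by have [_|/s_odd->] := boolP (odd #|A|); rewrite ?mulr0 ?oppr0 // mulN1r.
Qed.

Lemma parityK : involutive (@parity R m).
Proof. by move=> s; apply/ffunP => A; rewrite !ffunE mulrA -expr2 sqrr_sign mul1r. Qed.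

Lemma parity_spin_rep X s : parity (spin_rep X s) = spin_rep X (parity s).
Proof.
rewrite /spin_rep linearZ linear_sum; congr (_ *: _); apply: eq_bigr => i _.
apply: (etrans (linearD (@parity R m) _ _)).
by congr (_ + _); apply: (etrans (parity_rho _ _)); rewrite (parity_rho _ s) (rhoN _ (rho _ _)) opprK.
Qed.

(** The sign e of the transposition decides symmetry. The sign a of moving the
    parity across decides which half spinor spaces pair to zero: those of
    opposite parity if a = 1, those of equal parity if a = -1. *)
Lemma form_type_of_signs (b : spinor R m -> spinor R m -> R) (e a : R) :
  bilinear_for *%R *%R b ->
  (forall s t, b s t = e * b t s) ->
  (forall s t, b (parity s) t = a * b s (parity t)) ->
  [/\ e = 1 -> form_sym b, e = -1 -> form_skew b,
      a = 1 -> half_orthogonal b & a = -1 -> half_isotropic b].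
Proof.
move=> [bl br] b_swap b_par.
have b0l t : b 0 t = 0.
  by have := bl t (-1) 0 0; rewrite scaler0 addr0 /= mulN1r addNr.
have b0r s : b s 0 = 0.
  by have := br s (-1) 0 0; rewrite scaler0 addr0 /= mulN1r addNr.
have bNl s t : b (- s) t = - b s t.
  by have := bl t (-1) s 0; rewrite /= scaleN1r b0l !addr0 mulN1r.
have bNr s t : b s (- t) = - b s t.
  by have := br s (-1) t 0; rewrite /= scaleN1r b0r !addr0 mulN1r.
split=> [e1|e1|a1|a1].
- by move=> s t; rewrite b_swap e1 mul1r.
- by move=> s t; rewrite b_swap e1 mulN1r.
- move=> s t /parity_even s_ev /parity_odd t_odd; split.
    by have := b_par s t; rewrite s_ev t_odd a1 bNr; lra.
  by have := b_par t s; rewrite s_ev t_odd a1 bNl; lra.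
split=> s t.
  by move=> /parity_even s_ev /parity_even t_ev; have := b_par s t;
    rewrite s_ev t_ev a1; lra.
by move=> /parity_odd s_odd /parity_odd t_odd; have := b_par s t;
  rewrite s_odd t_odd a1 bNl bNr; lra.
Qed.

End Embeddings.

(** * Infinitesimal rotations *)

Section Plane.
Variables (R : realType) (m : nat).
Implicit Types (v w x y : hyp_space R m) (s t : spinor R m).

(** The element of so(m,m) that rotates the span of x and y and kills its
    orthogonal complement; on S it acts by (rho(x) rho(y) - rho(y) rho(x)) / 4. *)
Definition plane x y v : hyp_space R m := scal x v *: y - scal y v *: x.

Lemma plane_linear x y : linear (plane x y).
Proof.
move=> c v w; rewrite /plane !(linearP (scal _)) /= !(scalerDl _ (c * _)) -!scalerA.
by rewrite opprD addrACA scalerBr.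
Qed.

HB.instance Definition _ x y :=
  GRing.isLinear.Build R _ _ _ (plane x y) (plane_linear x y).

Lemma scal_plane x y v w :
  scal w (plane x y v) = scal x v * scal w y - scal y v * scal w x.
Proof.
have scB a b : scal w (a - b) = scal w a - scal w b 
  by rewrite addrC -scaleN1r scal_linear mulN1r addrC.
have scZ (c : R) a : scal w (c *: a) = c * scal w a by exact: (linearZ_LR (scal w)).
exact: (etrans (scB _ _) (congr2 (fun p q => p - q) (scZ _ _) (scZ _ _))).
Qed.

Lemma plane_skew x y : skew_endo (plane x y).
Proof.
move=> v w; rewrite scalC !scal_plane (scalC w x) (scalC w y) (scalC v x) (scalC v y).
ring.
Qed.

End Plane.

(** * Equivariant maps are determined by two values *)

Section Uniqueness.
Variables (R : realType) (m : nat).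
Implicit Types (i k : 'I_m) (v w x y : hyp_space R m) (s t : spinor R m).
Notation eU := (baseU R).
Notation eUd := (baseUd R).

(** Equivariant linear maps from V to the bilinear forms on S. Injectivity is
    left out, so that these maps are stable under linear combinations. *)
Definition equivariant (j : hyp_space R m -> spinor R m -> spinor R m -> R) :=
  [/\ forall v, bilinear_for *%R *%R (j v),
      forall s t, scalar (fun v => j v s t)
    & forall X : {linear hyp_space R m -> hyp_space R m}, skew_endo X ->
        forall v s t,
          j (X v) s t = - j v (spin_rep X s) t - j v s (spin_rep X t)].

Lemma equivariant_of_embedding j : equivariant_embedding j -> equivariant j.
Proof. by case. Qed.

Lemma equivariantB j j' c : equivariant j -> equivariant j' ->
  equivariant (fun v s t => j v s t - c * j' v s t).
Proof.
move=> [jb js je] [jb' js' je']; split=> [v | s t | X skX v s t].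
- split=> [t a s s' | s a t t'] /=.
    by rewrite ((jb v).1 t a s s') ((jb' v).1 t a s s') /=; ring.
  by rewrite ((jb v).2 s a t t') ((jb' v).2 s a t t') /=; ring.
- by move=> a v w; rewrite (js s t a v w) (js' s t a v w) /=; ring.
- by rewrite je // je' //; ring.
Qed.

Notation vac := (ebase R (set0 : {set 'I_m})).

Lemma rho_eUd_vacuum i : rho (eUd i) vac = 0.
Proof. by rewrite rho_baseUd annih_ebase0 ?inE // scaler0. Qed.

Lemma rho_eUd_vector i k :
  rho (eUd i) (rho (eU k) vac) = - (2 * (i == k)%:R) *: vac.
Proof.
by rewrite -(addr0 (rho _ _)) -(linear0 (rho (eU k))) -(rho_eUd_vacuum i)
  rho_anticomm scalDU.
Qed.

(** The operators rho(e_i) rho(e_i^star) are, up to the factor -2, the number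
    operators of the basis: they are diagonal with eigenvalues 0 and -2. *)
Lemma number_vector i k :
  rho (eU i) (rho (eUd i) (rho (eU k) vac)) = - (2 * (i == k)%:R) *: rho (eU k) vac.
Proof.
rewrite rho_eUd_vector rhoZ.
by case: eqVneq => [->//|_]; rewrite mulr0 oppr0 !scale0r.
Qed.

Lemma number_ebase i (B : {set 'I_m}) :
  rho (eU i) (rho (eUd i) (ebase R B)) = - (2 * (i \in B)%:R) *: ebase R B.
Proof.
rewrite rho_baseUd rhoZ rho_baseU.
have [iB | iB] := boolP (i \in B); last first.
  by rewrite annih_ebase0 // (linear0 (create i)) scaler0 mulr0 oppr0 scale0r.
rewrite -(setD1K iB) annih_ebase ?setD11 // (linearZ_LR (create i)) /=.
by rewrite create_ebase ?setD11 // !scalerA mulr1 -mulrA -expr2 sqrr_sign mulr1.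
Qed.

Variable j : hyp_space R m -> spinor R m -> spinor R m -> R.
Hypothesis j_equiv : equivariant j.

Lemma jPv c v w s t : j (c *: v + w) s t = c * j v s t + j w s t.
Proof. by case: j_equiv => _ js _; exact: js. Qed.

Lemma jPl c v s s' t : j v (c *: s + s') t = c * j v s t + j v s' t.
Proof. by case: j_equiv => /(_ v)[jl _] _ _; exact: jl. Qed.

Lemma jPr c v s t t' : j v s (c *: t + t') = c * j v s t + j v s t'.
Proof. by case: j_equiv => /(_ v)[_ jr] _ _; exact: jr. Qed.

Lemma j0v s t : j 0 s t = 0.
Proof. by have := jPv (-1) 0 0 s t; rewrite scaler0 addr0 mulN1r addNr. Qed.

Lemma j0l v t : j v 0 t = 0.
Proof. by have := jPl (-1) v 0 0 t; rewrite scaler0 addr0 mulN1r addNr. Qed.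

Lemma j0r v s : j v s 0 = 0.
Proof. by have := jPr (-1) v s 0 0; rewrite scaler0 addr0 mulN1r addNr. Qed.

Lemma jZl c v s t : j v (c *: s) t = c * j v s t.
Proof. by have := jPl c v s 0 t; rewrite j0l !addr0. Qed.

Lemma jZr c v s t : j v s (c *: t) = c * j v s t.
Proof. by have := jPr c v s t 0; rewrite j0r !addr0. Qed.

Lemma jZv c v s t : j (c *: v) s t = c * j v s t.
Proof. by have := jPv c v 0 s t; rewrite j0v !addr0. Qed.

(** The equivariance condition for [plane x y], with rho(y) rho(x) eliminated
    by means of the Clifford relation. *)
Lemma j_plane x y v s t :
  j (plane x y v) s t = - 2^-1 * (j v (rho x (rho y s)) t + j v s (rho x (rho y t)))
                        - scal x y * j v s t.
Proof.
have spE r : spin_rep (plane x y) r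
    = 2^-1 *: rho x (rho y r) + (2^-1 * scal x y) *: r.
  rewrite [LHS]spin_rep_plane.
  have -> : rho y (rho x r) = - (2 * scal x y) *: r - rho x (rho y r).
    by rewrite -rho_anticomm addrC addKr.
  move: (rho x _) => z; apply/ffunP => A; rewrite !ffunE /GRing.scale /=.
  by field.
case: j_equiv => _ _ /(_ (plane x y) (@plane_skew _ _ x y)) je.
apply: (etrans (je v s t)); rewrite !spE jPl jZl jPr jZr.
by field.
Qed.

(** The common left kernel of the forms j(v). *)
Definition left_null s := forall v t, j v s t = 0.

Lemma left_null_rho2 x y s : left_null s -> left_null (rho x (rho y s)).
Proof.
move=> s0 v t; have := j_plane x y v s t; rewrite !s0; lra.
Qed.

Lemma left_null_lin c s s' : left_null s -> left_null s' -> left_null (c *: s + s').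
Proof. by move=> s0 s0' v t; rewrite jPl s0 s0' mulr0 addr0. Qed.

(** The property proved by generation is that s and all rho(v) s lie in the
    left kernel: it is stable under every rho(w), since the kernel is stable
    under every rho(v) rho(w). *)
Lemma left_null_full i0 : left_null vac -> left_null (rho (eU i0) vac) ->
  forall s, left_null s.
Proof.
move=> vac0 one0.
have null0 : left_null 0 by move=> v t; exact: j0l.
suff full s : left_null s /\ forall v, left_null (rho v s) by move=> s; case: (full s).
elim/spinor_ind: s => [c s s' [s0 Rs0] [s0' Rs0'] ||i s [s0 Rs0]].
- split=> [|v]; first exact: left_null_lin.
  by rewrite (rhoD v (c *: s)) (rhoZ c v s); apply: left_null_lin.
- split=> // v; elim/hyp_space_ind: v => [|c v w Pv Pw|i|i].
  + by rewrite rho0l.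
  + by rewrite (rhoDl (c *: v) w) (rhoZl c v vac); apply: left_null_lin.
  + have := left_null_rho2 (eU i) (eUd i0) one0.
    rewrite rho_eUd_vector eqxx mulr1.
    by move=> H v t; have := H v t; rewrite rhoZ jZl; lra.
  + by rewrite rho_eUd_vacuum.
- by rewrite -rho_baseU; split=> // v; apply: left_null_rho2.
Qed.

(** The rotation [plane (eU i) (eUd i)] acts on s with weight 1/2 - a and on e_B
    with weight -1/2 or 1/2, according to whether i is in B. A weight vector v
    with j(v)(s, e_B) nonzero must have the opposite of the total weight. *)
Lemma j_weight i a v s (B : {set 'I_m}) :
  rho (eU i) (rho (eUd i) s) = - (2 * a) *: s ->
  j (plane (eU i) (eUd i) v) s (ebase R B) = (a + (i \in B)%:R - 1) * j v s (ebase R B).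
Proof.
move=> sa; rewrite j_plane sa number_ebase jZl jZr scalUD eqxx mul1r.
by field.
Qed.

Lemma j_eq0 v s : (forall B, j v s (ebase R B) = 0) -> forall t, j v s t = 0.
Proof.
move=> jB; elim/spinor_lin_ind => [|c t t' IHt IHt'|//]; first exact: j0r.
by rewrite jPr IHt IHt' mulr0 addr0.
Qed.

Lemma plane_eU i k : plane (eU i) (eUd i) (eU k) = - (i == k)%:R *: eU k.
Proof.
rewrite /plane scalUU scalDU scale0r sub0r scaleNr.
by case: eqVneq => [->//|_]; rewrite !scale0r.
Qed.

Lemma plane_eUd i k : plane (eU i) (eUd i) (eUd k) = (i == k)%:R *: eUd k.
Proof.
rewrite /plane scalDD scalUD scale0r subr0.
by case: eqVneq => [->//|_]; rewrite !scale0r.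
Qed.

(** The weights of e_k^star and s would force e_B to have weight -3/2. *)
Lemma j_eUd_annih k s t : rho (eUd k) s = 0 -> j (eUd k) s t = 0.
Proof.
move=> s0; move: t; apply: j_eq0 => B.
have sN : rho (eU k) (rho (eUd k) s) = - (2 * 0) *: s.
  by rewrite s0 (linear0 (rho _)) mulr0 oppr0 scale0r.
have := j_weight (eUd k) B sN; rewrite plane_eUd eqxx jZv.
by case: (k \in B) => /=; lra.
Qed.

(** The coordinate at e_(~: {i0}) of j(e_i0)(1, _) is the only one allowed by
    the weights; for k distinct from i0, the rotation [plane (eU k) (eUd i0)]
    kills the vacuum and carries e_i0 to -e_k. *)
Lemma left_null_vacuum i0 :
  j (eU i0) vac (ebase R (~: [set i0])) = 0 -> left_null vac.
Proof.
move=> j_top.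
have N0 i : rho (eU i) (rho (eUd i) vac) = - (2 * 0) *: vac.
  by rewrite rho_eUd_vacuum (linear0 (rho _)) mulr0 oppr0 scale0r.
have j_i0 t : j (eU i0) vac t = 0.
  move: t; apply: j_eq0 => B; have [->//|] := eqVneq B (~: [set i0]).
  apply: contra_neq_eq => jB; apply/setP => i; rewrite !inE.
  have /eqP := j_weight (eU i0) B (N0 i); rewrite plane_eU jZv -subr_eq0 -mulrBl.
  rewrite mulf_eq0 (negPf jB) orbF.
  by case: (eqVneq i i0) => _; case: (i \in B) => //= /eqP; lra.
move=> v t; elim/hyp_space_ind: v => [|c v w Pv Pw|k|k].
- exact: j0v.
- by rewrite jPv Pv Pw mulr0 addr0.
- have := j_plane (eU k) (eUd i0) (eU i0) vac t.
  rewrite rho_eUd_vacuum (linear0 (rho _)) j0l !j_i0.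
  rewrite /plane scalUU scalDU eqxx scale0r scale1r sub0r -scaleN1r jZv; lra.
- by apply: j_eUd_annih; exact: rho_eUd_vacuum.
Qed.

(** The coordinate at e_T of j(e_i0^star)(e_i0, _), with T the full set, is the
    only one allowed by the weights; for k distinct from i0, the rotation
    [plane (eU i0) (eU k)] kills the spinor e_i0 and carries e_i0^star to
    e_k. *)
Lemma left_null_vector i0 :
  j (eUd i0) (rho (eU i0) vac) (ebase R setT) = 0 -> left_null (rho (eU i0) vac).
Proof.
move=> j_top; set s := rho _ vac in j_top *.
have N i : rho (eU i) (rho (eUd i) s) = - (2 * (i == i0)%:R) *: s.
  exact: number_vector.
have j_i0 t : j (eUd i0) s t = 0.
  move: t; apply: j_eq0 => B; have [->//|] := eqVneq B setT.
  apply: contra_neq_eq => jB; apply/setP => i; rewrite !inE.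
  have /eqP := j_weight (eUd i0) B (N i); rewrite plane_eUd jZv -subr_eq0 -mulrBl.
  rewrite mulf_eq0 (negPf jB) orbF.
  by case: (eqVneq i i0) => _; case: (i \in B) => //= /eqP; lra.
move=> v t; elim/hyp_space_ind: v => [|c v w Pv Pw|k|k].
- exact: j0v.
- by rewrite jPv Pv Pw mulr0 addr0.
- have [-> | ki] := eqVneq k i0.
    move: t; apply: j_eq0 => B; have := j_weight (eU i0) B (N i0).
    by rewrite plane_eU !eqxx jZv; case: (_ \in B) => /=; lra.
  have := j_plane (eU i0) (eU k) (eUd i0) s t; rewrite !j_i0.
  have -> : rho (eU i0) (rho (eU k) s) = 0.
    have := rho_anticomm (eU i0) (eU k) s; rewrite scalUU mulr0 oppr0 scale0r.
    rewrite [X in _ + rho _ X]clifford_relation scalUU oppr0 scale0r (linear0 (rho _)).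
    by rewrite addr0.
  rewrite j0l /plane scalUD eqxx scale1r scalUD (negPf ki) scale0r subr0; lra.
have [-> //| ki] := eqVneq k i0.
apply: j_eUd_annih; have := rho_anticomm (eUd k) (eU i0) vac.
by rewrite rho_eUd_vacuum (linear0 (rho _)) addr0 scalDU (negPf ki) mulr0 oppr0 scale0r.
Qed.

Lemma equivariant_eq0 i0 :
  j (eU i0) vac (ebase R (~: [set i0])) = 0 ->
  j (eUd i0) (rho (eU i0) vac) (ebase R setT) = 0 ->
  forall v s t, j v s t = 0.
Proof.
move=> j1 j2 v s t; apply: (@left_null_full i0).
  exact: left_null_vacuum j1.
exact: left_null_vector j2.
Qed.

End Uniqueness.

(** * The span of j_rho(f) and j_rho(f_E) *)

Section Signs.
Variable R : realType.

Lemma odd_triangular q r :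
  odd ((4 * q + r) * (4 * q + r).+1)./2 = odd (r * r.+1)./2.
Proof.
have -> : ((4 * q + r) * (4 * q + r).+1 = (8 * q * q + 4 * q * r + 2 * q).*2 + r * r.+1)%N.
  by rewrite -muln2; ring.
rewrite halfD odd_double doubleK /= oddD.
by rewrite !oddD !oddM /= addbF addbb addFb.
Qed.

Lemma triangular_sign_mod4 m :
  (-1) ^+ (m * m.+1)./2 = (-1) ^+ ((m %% 4 * (m %% 4).+1)./2) :> R.
Proof.
rewrite -[LHS]signr_odd -[RHS]signr_odd; congr (_ ^+ _).
by rewrite -(odd_triangular (m %/ 4) (m %% 4)) (mulnC 4) -divn_eq.
Qed.

Lemma sign_mod4 m : (-1) ^+ m = (-1) ^+ (m %% 4) :> R.
Proof.
rewrite -[LHS]signr_odd -[RHS]signr_odd; congr (_ ^+ _).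
by rewrite {1}(divn_eq m 4) oddD oddM andbF.
Qed.

End Signs.

Section FormE.
Variables (R : realType) (m : nat) (vol : spinor R m).
Hypotheses (vol_top : ext_power m vol) (vol_neq0 : vol <> 0).
Variable f : {biscalar (spinor R m)}.
Hypothesis f_spec : spinor_form_spec vol f.
Implicit Types (v : hyp_space R m) (s t : spinor R m).

Let fP := form_parity vol_top vol_neq0 f_spec.
Let fR := form_rho vol_top vol_neq0 f_spec.
Let fC := spinor_formC vol_top vol_neq0 f_spec.
Let fnd := form_nondegenerate f_spec.

Lemma j_rho_f_embedding : equivariant_embedding (j_rho f).
Proof.
apply: j_rho_embedding => [|s|X skX s t].
- by split=> [t c s s' | s c t t'] /=; [exact: biscalarPl | exact: biscalarPr].
- exact: fnd.
- exact: (form_spin_rep vol_top vol_neq0 f_spec).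
Qed.

Lemma j_rho_fE_embedding : equivariant_embedding (j_rho (form_E f)).
Proof.
apply: j_rho_embedding => [|s|X skX s t].
- split=> [t c s s' | s c t t'] /=; last exact: biscalarPr.
  by rewrite /form_E (linearP (@parity R m)); exact: biscalarPl.
- move=> s0; rewrite -[s](@parityK R m) [parity s]fnd ?linear0 // => t.
- rewrite /form_E parity_spin_rep; exact: (form_spin_rep vol_top vol_neq0 f_spec).
Qed.

Lemma j_rho_f_swap v s t :
  j_rho f v s t = - (-1) ^+ (m * m.+1)./2 * j_rho f v t s.
Proof. by rewrite /j_rho fR fC mulNr. Qed.

Lemma j_rho_fE_swap v s t :
  j_rho (form_E f) v s t
    = (-1) ^+ m * (-1) ^+ (m * m.+1)./2 * j_rho (form_E f) v t s.
Proof.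
rewrite /j_rho /form_E fP fR fC parity_rho biscalarNl; ring.
Qed.

Lemma j_rho_f_parity v s t :
  j_rho f v (parity s) t = - (-1) ^+ m * j_rho f v s (parity t).
Proof.
by rewrite /j_rho -[rho v (parity s)]opprK -parity_rho biscalarNl fP mulNr.
Qed.

Lemma j_rho_fE_parity v s t :
  j_rho (form_E f) v (parity s) t = - (-1) ^+ m * j_rho (form_E f) v s (parity t).
Proof.
by rewrite /j_rho /form_E -[rho v (parity s)]opprK -parity_rho linearN /= biscalarNl fP mulNr.
Qed.

Lemma equivariant_embedding_span (i0 : 'I_m) j : equivariant_embedding j ->
  exists c d : R, forall v s t,
    j v s t = c * j_rho f v s t + d * j_rho (form_E f) v s t.
Proof.
move=> /equivariant_of_embedding j_eq.
have f_eq := equivariant_of_embedding j_rho_f_embedding.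
have fE_eq := equivariant_of_embedding j_rho_fE_embedding.
pose vac := ebase R (set0 : {set 'I_m}).
pose top1 := ebase R (~: [set i0]); pose e0 := rho (baseU R i0) vac.
pose p := f e0 top1; pose q := f (rho (baseUd R i0) e0) (ebase R setT).
have p_neq0 : p != 0.
  rewrite /p /e0 rho_baseU create_ebase ?inE // setU0 biscalarZl mulf_neq0 ?signr_eq0 //.
  exact: (form_ebase_neq0 f_spec).
have e0K : rho (baseUd R i0) e0 = - 2 *: vac.
  by rewrite /e0 rho_eUd_vector eqxx mulr1.
have q_neq0 : q != 0.
  rewrite /q e0K biscalarZl mulf_neq0 ?oppr_eq0 ?pnatr_eq0 //.
  by rewrite -setC0; exact: (form_ebase_neq0 f_spec).
have vacE : parity vac = vac by rewrite /vac parity_ebase cards0 scale1r.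
(* The coefficients solve c - d = a and c + d = b, because j_rho(f_E) takes
   the values -p and q where j_rho(f) takes the values p and q. *)
pose a := j (baseU R i0) vac top1 / p.
pose b := j (baseUd R i0) e0 (ebase R setT) / q.
exists ((a + b) / 2), ((b - a) / 2) => v s t.
apply/eqP; rewrite -subr_eq0 opprD addrA; apply/eqP; move: v s t.
apply: (equivariant_eq0 (equivariantB _ (equivariantB _ j_eq f_eq) fE_eq) (i0 := i0)).
  have -> : j_rho f (baseU R i0) vac top1 = p by [].
  have -> : j_rho (form_E f) (baseU R i0) vac top1 = - p.
    by rewrite /j_rho /form_E parity_rho vacE biscalarNl.
  by rewrite -[j _ _ _](divfK p_neq0) -/a; field.
have -> : j_rho f (baseUd R i0) e0 (ebase R setT) = q by [].
have -> : j_rho (form_E f) (baseUd R i0) e0 (ebase R setT) = q.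
  by rewrite /j_rho /form_E /q e0K linearZ /= vacE.
by rewrite -[j _ _ _](divfK q_neq0) -/b; field.
Qed.

End FormE.

Theorem theorem3p5 (R : realType) (m : nat) (m_gt0 : (0 < m)%N)
    (vol : spinor R m) (vol_top : ext_power m vol) (vol_neq0 : vol <> 0)
    (f : {biscalar (spinor R m)}) (f_spec : spinor_form_spec vol f) :
  [/\ equivariant_embedding (j_rho f),
      equivariant_embedding (j_rho (form_E f)),
      forall j : hyp_space R m -> spinor R m -> spinor R m -> R,
        equivariant_embedding j ->
        exists c d : R, forall v s t,
          j v s t = c * j_rho f v s t + d * j_rho (form_E f) v s t
    & [/\ (m %% 4 = 1)%N ->
            (forall v, in_sym2_dual (j_rho f v)) /\
            (forall v, in_sym2_dual (j_rho (form_E f) v)),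
          (m %% 4 = 2)%N ->
            (forall v, in_sym_mixed_dual (j_rho f v)) /\
            (forall v, in_alt_mixed_dual (j_rho (form_E f) v)),
          (m %% 4 = 3)%N ->
            (forall v, in_alt2_dual (j_rho f v)) /\
            (forall v, in_alt2_dual (j_rho (form_E f) v))
        & (m %% 4 = 0)%N ->
            (forall v, in_alt_mixed_dual (j_rho f v)) /\
            (forall v, in_sym_mixed_dual (j_rho (form_E f) v))]].
Proof.
have emb_f := j_rho_f_embedding vol_top vol_neq0 f_spec.
have emb_fE := j_rho_fE_embedding vol_top vol_neq0 f_spec.
split=> //.
  move=> j; exact: (equivariant_embedding_span vol_top vol_neq0 f_spec (Ordinal m_gt0)).
have [f_bil _ _ _] := emb_f; have [fE_bil _ _ _] := emb_fE.
have type_f v := form_type_of_signs (f_bil v)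
  (j_rho_f_swap vol_top vol_neq0 f_spec v) (j_rho_f_parity vol_top vol_neq0 f_spec v).
have type_fE v := form_type_of_signs (fE_bil v)
  (j_rho_fE_swap vol_top vol_neq0 f_spec v) (j_rho_fE_parity vol_top vol_neq0 f_spec v).
rewrite (sign_mod4 R m) (triangular_sign_mod4 R m) in type_f type_fE.
split=> m4; rewrite m4 in type_f type_fE; split=> v;
  have [f_sym f_skew f_orth f_iso] := type_f v;
  have [fE_sym fE_skew fE_orth fE_iso] := type_fE v.
- by split; [apply: f_sym | apply: f_orth] => /=; ring.
- by split; [apply: fE_sym | apply: fE_orth] => /=; ring.
- by split; [apply: f_sym | apply: f_iso] => /=; ring.
- by split; [apply: fE_skew | apply: fE_iso] => /=; ring.
- by split; [apply: f_skew | apply: f_orth] => /=; ring.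
- by split; [apply: fE_skew | apply: fE_orth] => /=; ring.
- by split; [apply: f_skew | apply: f_iso] => /=; ring.
- by split; [apply: fE_sym | apply: fE_iso] => /=; ring.
Qed.
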